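(* Let $A\in\Gamma$ be an even formal power series. Then for any decomposition $A=A_1\circ A_2$ with $A_1,A_2\in\Gamma$, either $A_2$ is even, or there exists $\mu\in k_1[[z]]$ such that $\mu^{-1}\circ A_2$ is odd and $A_1\circ\mu$ is even. On the other hand, if $A\in\Gamma$ is odd, then for any decomposition $A=A_1\circ A_2$ with $A_1,A_2\in\Gamma$ there exists $\mu\in k_1[[z]]$ such that $A_1\circ\mu$ and $\mu^{-1}\circ A_2$ are odd.
   Context: $k$ is an algebraically closed field of characteristic zero and $k[[z]]$ is the ring of formal power series over $k$. The order of a nonzero series is the smallest exponent with nonzero coefficient. $k_1[[z]]$ is the group under composition $\circ$ of series of order exactly $1$, and $\Gamma$ is the semigroup under $\circ$ of (nonzero) series of order at least $2$. A series is even if it has the form $R(z^2)$, and odd if it has the form $zR(z^2)$, for some $R\in k[[z]]$. *)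

(* Defs.v *)
From mathcomp Require Import all_boot all_order all_algebra.

Set Implicit Arguments.
Unset Strict Implicit.
Unset Printing Implicit Defensive.

Import GRing.Theory.
Local Open Scope ring_scope.

(* A formal power series sum_n (A n) z^n is its coefficient sequence; equality
   of series is pointwise equality [=1]. *)
Definition fps (k : nzRingType) := nat -> k.

Definition fps_Xn (k : nzRingType) (m : nat) : fps k := fun n => (n == m)%:R.

Definition fps_mul (k : nzRingType) (A B : fps k) : fps k :=
  fun n => \sum_(i < n.+1) A i * B (n - i)%N.

Definition fps_exp (k : nzRingType) (A : fps k) (m : nat) : fps k :=
  iter m (fps_mul A) (fps_Xn k 0).

(* A(B(z)) = sum_i (A i) B(z)^i.  This is only meaningful when B has zero
   constant term: then z^i divides B^i, so that the terms with i > n do not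
   contribute to the coefficient of z^n and the sum stops at i = n. *)
Definition fps_comp (k : nzRingType) (A B : fps k) : fps k :=
  fun n => \sum_(i < n.+1) A i * fps_exp B i n.

Definition has_order (k : nzRingType) (A : fps k) (n : nat) : Prop :=
  A n != 0 /\ (forall m : nat, (m < n)%N -> A m = 0).

(* The group k_1[[z]]. *)
Definition in_k1 (k : nzRingType) (A : fps k) : Prop := has_order A 1.

(* Having an order makes A nonzero. *)
Definition in_Gamma (k : nzRingType) (A : fps k) : Prop :=
  exists2 n : nat, (2 <= n)%N & has_order A n.

(* nu is the inverse of mu in the group k_1[[z]], whose identity is z. *)
Definition is_k1_inverse (k : nzRingType) (mu nu : fps k) : Prop :=
  [/\ in_k1 mu, in_k1 nu,
      fps_comp mu nu =1 fps_Xn k 1 & fps_comp nu mu =1 fps_Xn k 1].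

Definition fps_even (k : nzRingType) (A : fps k) : Prop :=
  exists R : fps k, A =1 fps_comp R (fps_Xn k 2).

Definition fps_odd (k : nzRingType) (A : fps k) : Prop :=
  exists R : fps k, A =1 fps_mul (fps_Xn k 1) (fps_comp R (fps_Xn k 2)).

(* Main.v *)
(* Extracting an n-th root, write A1 = nu^n with nu of order 1 and n the order of
   A1, and let mu be the inverse of nu, so that A1 o mu = z^n. Then
   B = nu o A2 has the order m of A2 and B^n = A. Since A(-z) = +-A(z), the
   series B(-z) and (-1)^m B(z) have the same n-th power and the same leading
   coefficient, hence coincide: B has the parity of m, and A that of n m. If A is
   odd, n and m are odd. If A is even and m odd, n is even; if m is even,
   nu(A2(-z)) = nu(A2(z)) and A2 itself is even. *)
Require Import Defs.
From mathcomp Require Import all_boot all_order all_algebra.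

Set Implicit Arguments.
Unset Strict Implicit.
Unset Printing Implicit Defensive.

Import GRing.Theory.
Local Open Scope ring_scope.

(** * Low-order coefficients of products, powers and compositions of polynomials *)

Section PolyCoef.
Variable R : comNzRingType.
Implicit Types p q : {poly R}.

Lemma coefM_low p q a b :
    (forall j, (j < a)%N -> p`_j = 0) -> (forall j, (j < b)%N -> q`_j = 0) ->
  (forall j, (j < a + b)%N -> (p * q)`_j = 0) /\
  (p * q)`_(a + b) = p`_a * q`_b.
Proof.
move=> p0 q0; split=> [j jab|].
  rewrite coefM big1 // => i _.
  have [ia|ai] := ltnP i a; first by rewrite p0 ?mul0r.
  by rewrite q0 ?mulr0 // ltn_subLR ?(leq_trans jab) ?leq_add2r -1?ltnS.
have ha : (a < (a + b).+1)%N by rewrite ltnS leq_addr.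
rewrite coefM (bigD1 (Ordinal ha)) //= addKn big1 ?addr0 // => i neq_ia.
have [ia|ai] := ltnP i a; first by rewrite p0 ?mul0r.
rewrite q0 ?mulr0 // ltn_subLR; last by rewrite -ltnS.
by rewrite ltn_add2r ltn_neqAle ai andbT eq_sym.
Qed.

Lemma coefX_low p m i : (forall j, (j < m)%N -> p`_j = 0) ->
  (forall j, (j < i * m)%N -> (p ^+ i)`_j = 0) /\ (p ^+ i)`_(i * m) = p`_m ^+ i.
Proof.
move=> p0; elim: i => [|i [IH0 IH1]]; first by rewrite !expr0 coef1.
by rewrite !exprS mulSn -IH1; apply: coefM_low.
Qed.

(** Factor p^(i+1) - q^(i+1) as (p - q) times the sum of the p^(i-l) q^l. Each of these i+1 products
    vanishes below degree i m and has coefficient q_m^i there, while p - q vanishes below degree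
    N. *)
Lemma coefX_sub p q m N i :
    (forall j, (j < m)%N -> p`_j = 0) -> (forall j, (j < m)%N -> q`_j = 0) ->
    p`_m = q`_m -> (forall j, (j < N)%N -> p`_j = q`_j) ->
  (p ^+ i.+1)`_(N + i * m) - (q ^+ i.+1)`_(N + i * m) =
  i.+1%:R * q`_m ^+ i * (p`_N - q`_N).
Proof.
move=> p0 q0 pqm pqN; rewrite -coefB subrXX.
set s := \sum_(_ < _) _.
have sE j : (j <= i * m)%N -> s`_j = (j == i * m)%:R * (i.+1%:R * q`_m ^+ i).
  move=> jm; rewrite coef_sum.
  rewrite (eq_bigr (fun=> (j == i * m)%:R * q`_m ^+ i)) => [|l _].
    by rewrite sumr_const card_ord -[LHS]mulr_natl mulrCA.
  have li : (l <= i)%N by rewrite -ltnS.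
  have [P0 P1] := coefX_low (i - l) p0; have [Q0 Q1] := coefX_low l q0.
  have [L0 L1] := coefM_low P0 Q0.
  rewrite -mulnDl subnK // in L0 L1.
  move: jm; rewrite leq_eqVlt => /predU1P[->|jm].
    by rewrite eqxx mul1r L1 P1 Q1 pqm -exprD subnK.
  by rewrite L0 // ltn_eqF // mul0r.
have [|j jm|_ ->] := @coefM_low (p - q) s N (i * m).
- by move=> j jN; rewrite coefB pqN ?subrr.
- by rewrite sE ?(ltnW jm) // ltn_eqF ?mul0r.
by rewrite sE // eqxx mul1r coefB mulrC.
Qed.

(** Since X divides q, the powers q^i with i > n do not reach degree n. This gives the range of
    summation used in [fps_comp]. *)
Lemma coef_comp_poly_low p q n : q`_0 = 0 ->
  (p \Po q)`_n = \sum_(i < n.+1) p`_i * (q ^+ i)`_n.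
Proof.
move=> q0; rewrite coef_comp_poly.
pose M := (size p + n.+1)%N.
rewrite (big_ord_widen M (fun i => p`_i * (q ^+ i)`_n)) ?leq_addr //.
rewrite [RHS](big_ord_widen M (fun i => p`_i * (q ^+ i)`_n)) ?leq_addl //.
rewrite big_mkcond [RHS]big_mkcond; apply: eq_bigr => i _ /=.
have [ip|pi] := ltnP i (size p); have [iN|Ni] := ltnP i n.+1 => //.
  have [|+ _] := @coefX_low q 1 i; first by case.
  by move=> ->; rewrite ?mulr0 // muln1.
by rewrite nth_default ?mul0r.
Qed.

End PolyCoef.

(** * Power series studied through polynomial truncations *)

Section Approx.
Variable R : comNzRingType.
Implicit Types (A B C : fps R) (p q : {poly R}).

(* A = p modulo z^N. *)
Definition approx N A p := forall n, (n < N)%N -> A n = p`_n.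

Definition trunc N A : {poly R} := \poly_(i < N) A i.

Lemma approx_trunc N A : approx N A (trunc N A).
Proof. by move=> n nN; rewrite coef_poly nN. Qed.

Lemma approx_Xn N m : approx N (fps_Xn R m) 'X^m.
Proof. by move=> n _; rewrite coefXn. Qed.

Lemma approx_mul N A B p q : approx N A p -> approx N B q ->
  approx N (fps_mul A B) (p * q).
Proof.
move=> Ap Bq n nN; rewrite coefM; apply: eq_bigr => i _.
by rewrite Ap ?Bq // (leq_ltn_trans _ nN) ?leq_subr // -ltnS.
Qed.

Lemma approx_exp N A p m : approx N A p -> approx N (fps_exp A m) (p ^+ m).
Proof.
move=> Ap; elim: m => [|m IH]; first exact: approx_Xn.
by rewrite exprS; apply: approx_mul.
Qed.

(** The zero constant term makes polynomial composition agree with the sum in [fps_comp], which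
    stops at i = n. *)
Lemma approx_comp N A B p q : B 0 = 0 -> approx N A p -> approx N B q ->
  approx N (fps_comp A B) (p \Po q).
Proof.
move=> B0 Ap Bq n nN; rewrite coef_comp_poly_low; last first.
  by rewrite -Bq // (leq_ltn_trans _ nN).
apply: eq_bigr => i _; rewrite (approx_exp _ Bq) // Ap //.
by rewrite (leq_ltn_trans _ nN) // -ltnS.
Qed.

Lemma fps_comp0 A B : fps_comp A B 0 = A 0%N.
Proof. by rewrite /fps_comp big_ord1 mulr1. Qed.

Lemma fps_exp_Xn m i : fps_exp (fps_Xn R m) i =1 fps_Xn R (m * i).
Proof.
move=> n; rewrite (approx_exp i (approx_Xn m) (ltnSn n)) -exprM.
by rewrite coefXn.
Qed.

Lemma eq_fps_exp A B i : A =1 B -> fps_exp A i =1 fps_exp B i.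
Proof.
move=> AB; elim: i => //= i IH n.
by apply: eq_bigr => j _; rewrite AB IH.
Qed.

Lemma eq_fps_comp A A' B B' : A =1 A' -> B =1 B' ->
  fps_comp A B =1 fps_comp A' B'.
Proof.
by move=> AA BB n; apply: eq_bigr => i _; rewrite AA (eq_fps_exp _ BB).
Qed.

Lemma fps_comp_Xn1 A : fps_comp A (fps_Xn R 1) =1 A.
Proof.
move=> n; rewrite /fps_comp big_ord_recr /= big1 => [|i _].
  by rewrite fps_exp_Xn mul1n /fps_Xn eqxx mulr1 add0r.
by rewrite fps_exp_Xn mul1n /fps_Xn gtn_eqF ?mulr0.
Qed.

Lemma fps_Xn1_comp A : A 0 = 0 -> fps_comp (fps_Xn R 1) A =1 A.
Proof.
move=> A0 n; rewrite (approx_comp A0 (approx_Xn 1) (approx_trunc A) (ltnSn n)).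
by rewrite comp_polyX -approx_trunc.
Qed.

(** Degree n only sees the truncations modulo z^(n+1), so associativity is inherited from
    polynomials. *)
Lemma fps_compA A B C : B 0 = 0 -> C 0 = 0 ->
  fps_comp A (fps_comp B C) =1 fps_comp (fps_comp A B) C.
Proof.
move=> B0 C0 n.
have h := @approx_trunc n.+1.
rewrite (approx_comp _ (h A) (approx_comp C0 (h B) (h C))) ?fps_comp0 //.
rewrite (approx_comp C0 (approx_comp B0 (h A) (h B)) (h C)) //.
by rewrite comp_polyA.
Qed.

Lemma fps_comp_exp A B m : B 0 = 0 ->
  fps_comp (fps_exp A m) B =1 fps_exp (fps_comp A B) m.
Proof.
move=> B0 n; have h := @approx_trunc n.+1.
rewrite (approx_comp B0 (approx_exp m (h A)) (h B)) //.
by rewrite (approx_exp m (approx_comp B0 (h A) (h B))) // rmorphXn.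
Qed.

Lemma fps_exp_low A m i : (forall j, (j < m)%N -> A j = 0) ->
  (forall j, (j < i * m)%N -> fps_exp A i j = 0) /\
  fps_exp A i (i * m)%N = A m ^+ i.
Proof.
move=> A0; pose N := (i * m + m).+1; have h := @approx_trunc N A.
have low j : (j < m)%N -> (trunc N A)`_j = 0.
  by move=> jm; rewrite -h ?A0 // ltnS (leq_trans (ltnW jm)) ?leq_addl.
have [L0 L1] := coefX_low i low; split=> [j jm|].
  by rewrite (approx_exp i h) ?L0 // ltnS (leq_trans (ltnW jm)) ?leq_addr.
by rewrite (approx_exp i h) ?L1 -?h // ltnS ?leq_addl ?leq_addr.
Qed.

Lemma fps_exp_sub A B m N i :
    (forall j, (j < m)%N -> A j = 0) -> (forall j, (j < m)%N -> B j = 0) ->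
    A m = B m -> (forall j, (j < N)%N -> A j = B j) ->
  fps_exp A i.+1 (N + i * m)%N - fps_exp B i.+1 (N + i * m)%N =
  i.+1%:R * B m ^+ i * (A N - B N).
Proof.
(* [M] exceeds every degree read below: N + i m, N and m. *)
move=> A0 B0 ABm ABN; pose M := (N + i * m + m).+1.
have [hA hB] := (@approx_trunc M A, @approx_trunc M B).
have mM j : (j <= m)%N -> (j < M)%N.
  by move=> jm; rewrite ltnS (leq_trans jm) ?leq_addl.
have NM j : (j <= N)%N -> (j < M)%N.
  by move=> jN; rewrite ltnS (leq_trans jN) // -addnA leq_addr.
rewrite !(approx_exp _ hA, approx_exp _ hB) ?ltnS ?leq_addr //.
rewrite (coefX_sub (m := m)); first by rewrite -(hB m) ?mM // -(hB N) ?NM // -hA ?NM.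
- by move=> j jm; rewrite -hA ?A0 // mM // ltnW.
- by move=> j jm; rewrite -hB ?B0 // mM // ltnW.
- by rewrite -hA ?mM // -hB ?mM.
by move=> j jN; rewrite -hA ?(NM _ (ltnW jN)) // -hB ?(NM _ (ltnW jN)) // ABN.
Qed.

(** Only the linear term of A contributes: by [fps_exp_sub] with m = 0, the difference of the i-th
    powers carries the factor C(0)^(i-1), which is zero for i > 1. *)
Lemma fps_comp_sub A B C N : B 0 = 0 -> C 0 = 0 ->
    (forall j, (j < N)%N -> B j = C j) ->
  fps_comp A B N - fps_comp A C N = A 1%N * (B N - C N).
Proof.
case: N => [|N] B0 C0 BC; first by rewrite !fps_comp0 B0 C0 !subrr mulr0.
rewrite /fps_comp -sumrB big_ord_recl big_ord_recl /= subrr add0r big1.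
  rewrite addr0 -mulrBr; have := @fps_exp_sub B C 0 N.+1 0.
  by rewrite muln0 addn0 mul1r mul1r => ->; rewrite ?B0 ?C0.
move=> i _; rewrite -mulrBr /bump /= !add1n.
have := @fps_exp_sub B C 0 N.+1 i.+1.
by rewrite muln0 addn0 C0 expr0n mulr0 mul0r => ->; rewrite ?B0 ?mulr0.
Qed.

End Approx.

(* Solves [Phi f = U] one coefficient at a time: the N-th coefficient of [Phi f]
   is [u * f N] plus a function of the lower coefficients of [f]. *)
Section Newton.
Variables (F : fieldType) (Phi : fps F -> fps F) (f0 : fps F) (s : nat) (u : F).
Hypothesis u_neq0 : u != 0.
Hypothesis Phi_sub : forall (f g : fps F) N, (s <= N)%N ->
  (forall j, (j < s)%N -> f j = f0 j) -> (forall j, (j < N)%N -> f j = g j) ->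
  Phi f N - Phi g N = u * (f N - g N).

Lemma newton_inj (f g : fps F) :
    (forall j, (j < s)%N -> f j = f0 j) -> (forall j, (j < s)%N -> g j = f0 j) ->
  Phi f =1 Phi g -> f =1 g.
Proof.
move=> ff0 gf0 Pfg N; elim/ltn_ind: N => N IH.
have [Ns|sN] := ltnP N s; first by rewrite ff0 ?gf0.
apply/eqP; rewrite -subr_eq0; apply/eqP/(mulfI u_neq0).
by rewrite mulr0 -Phi_sub // Pfg subrr.
Qed.

Variable U : fps F.
Hypothesis Phi_low : forall f : fps F, (forall j, (j < s)%N -> f j = f0 j) ->
  forall j, (j < s)%N -> Phi f j = U j.

(** Stage N+1 changes coefficient N alone, and only if N >= s, by the correction that makes [Phi f]
    match [U] in degree N. *)
Fixpoint newton_iter N : fps F :=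
  if N is N'.+1 then
    let f := newton_iter N' in
    fun n => if (n == N') && (s <= N')%N then f n + (U n - Phi f n) / u else f n
  else f0.

Lemma newton_iter_low N j : (j < s)%N -> newton_iter N j = f0 j.
Proof.
move=> js; elim: N => //= N IH.
by case: ifP => // /andP[/eqP <-]; rewrite leqNgt js.
Qed.

Lemma newton_iter_stable N j : (j < N)%N -> newton_iter N j = newton_iter j.+1 j.
Proof.
elim: N => // N IH; rewrite ltnS leq_eqVlt => /predU1P[-> //|jN].
by rewrite -IH //= ltn_eqF.
Qed.

Lemma newton_exists :
  exists2 f : fps F, forall j, (j < s)%N -> f j = f0 j & Phi f =1 U.
Proof.
(* The diagonal is the limit of the stages, as coefficient n is final from stage n+1 on. *)
pose f : fps F := fun n => newton_iter n.+1 n.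
have flow j : (j < s)%N -> f j = f0 j by exact: newton_iter_low.
exists f => // N; have [Ns|sN] := ltnP N s; first exact: Phi_low.
have fN : f N = newton_iter N N + (U N - Phi (newton_iter N) N) / u.
  by rewrite /f /= eqxx sN.
(* The limit and stage N agree below degree N, so [Phi_sub] compares their images in degree N. *)
apply: (addIr (- Phi (newton_iter N) N)).
rewrite Phi_sub // => [|j jN]; last by rewrite [RHS]newton_iter_stable.
by rewrite fN addrC addKr mulrC divfK.
Qed.

End Newton.

(** * Roots and compositional inverses of power series *)

Section Field.
Variable F : fieldType.
Implicit Types A B C : fps F.

(** By [fps_exp_sub], coefficient N of a series with leading term A_m z^m enters coefficient N + i m
    of its power with the nonzero factor (i+1) A_m^i. Hence [Phi] is the power with its degrees
    shifted by i m. *)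
Lemma fps_exp_inj A B m i : i.+1%:R != 0 :> F -> has_order A m -> has_order B m ->
  A m = B m -> fps_exp A i.+1 =1 fps_exp B i.+1 -> A =1 B.
Proof.
move=> i0 [Am A0] [Bm B0] AB eAB.
pose u := i.+1%:R * A m ^+ i.
have u0 : u != 0 by rewrite mulf_neq0 ?expf_neq0.
pose Phi C : fps F := fun N => fps_exp C i.+1 (N + i * m)%N.
apply: (@newton_inj _ Phi A m.+1 u u0) => // [f g N mN fA fg|j|N].
- have low j : (j < m)%N -> f j = 0 by move=> jm; rewrite fA ?A0 // ltnW.
  rewrite /Phi (fps_exp_sub (m := m)) //; last by rewrite fg.
    by rewrite -fg // fA.
  by move=> j jm; rewrite -fg ?low // (ltn_trans jm).
- by rewrite ltnS leq_eqVlt => /predU1P[-> //|jm]; rewrite A0 ?B0.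
exact: eAB.
Qed.

(** The root is built from c z: coefficients 0 and 1 are prescribed, so s = 2, and the later ones
    are solved for one at a time. *)
Lemma fps_root A c i : i.+1%:R != 0 :> F -> has_order A i.+1 ->
  A i.+1 = c ^+ i.+1 -> exists2 B, in_k1 B & A =1 fps_exp B i.+1.
Proof.
move=> i0 [Ai A0] Ac.
have c0 : c != 0 by apply: contraNneq Ai => c0; rewrite Ac c0 expr0n.
pose u := i.+1%:R * c ^+ i.
have u0 : u != 0 by rewrite mulf_neq0 ?expf_neq0.
pose Phi C : fps F := fun N => fps_exp C i.+1 (N + i * 1)%N.
pose f0 : fps F := fun n => (n == 1)%:R * c.
have low (f : fps F) : (forall j, (j < 2)%N -> f j = f0 j) ->
    (forall j, (j < 1)%N -> f j = 0) /\ f 1%N = c.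
  move=> ff0; split=> [[|//] _|]; last by rewrite ff0 // /f0 mul1r.
  by rewrite ff0 // /f0 mul0r.
have [|f ff0 fA|B B0 BA] :=
  @newton_exists _ Phi f0 2 u u0 _ (fun N => A (N + i * 1)%N).
- move=> f g N mN ff0 fg; have [f1 fc] := low f ff0.
  rewrite /Phi (fps_exp_sub (m := 1)) //; last by rewrite fg.
    by rewrite -fg // fc.
  by move=> j jm; rewrite -fg ?f1 // (ltn_trans jm).
- have [f1 fc] := low f ff0; have [L0 L1] := fps_exp_low i.+1 f1.
  case: fA => [|[|//]] _; rewrite /Phi muln1.
    by rewrite L0 ?A0 // muln1.
  by rewrite -[(1 + i)%N]muln1 L1 fc muln1 Ac.
have [B1 Bc] := low B B0; exists B; first by split=> //; rewrite Bc.
(* The shifted equation says nothing about degrees below i, where both sides vanish. *)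
move=> n; have [ni|ni] := ltnP n i; last first.
  by have := BA (n - i)%N; rewrite /Phi muln1 subnK.
have [L0 _] := fps_exp_low i.+1 B1.
by rewrite L0 ?A0 // ?muln1 ltnS ltnW.
Qed.

Lemma fps_comp_low A B m j : (0 < m)%N -> A 0 = 0 ->
    (forall l, (l < m)%N -> B l = 0) -> (j <= m)%N ->
  fps_comp A B j = A 1%N * B j.
Proof.
move=> m0 A0 B0; case: j => [|j] jm; first by rewrite fps_comp0 A0 B0 ?mulr0.
(* Up to degree m, B is compared with the zero series, whose image under A is zero. *)
have h := @fps_comp_sub _ A B (fun=> 0) j.+1.
rewrite subr0 in h; rewrite -h ?B0 //; last first.
  by move=> l lj; rewrite B0 // (leq_trans lj).
rewrite [X in _ - X]/fps_comp big_ord_recl A0 // mul0r add0r big1 ?subr0 //.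
move=> i _; rewrite [fps_exp _ _]/= [fps_mul _ _ _]big1 ?mulr0 // => l _.
by rewrite mul0r.
Qed.

Lemma k1_0 A : in_k1 A -> A 0 = 0.
Proof. by case=> _; apply. Qed.

Lemma fps_comp_inj A B C : in_k1 A -> B 0 = 0 -> C 0 = 0 ->
  fps_comp A B =1 fps_comp A C -> B =1 C.
Proof.
move=> [A1 _] B0 C0.
apply: (@newton_inj _ (fps_comp A) (fps_Xn F 1) 1 (A 1%N)) => //; last 2 first.
- by case=> // _; rewrite B0.
- by case=> // _; rewrite C0.
move=> f g N N0 f0 fg; apply: fps_comp_sub => //; last rewrite -fg //.
  exact: f0.
exact: f0.
Qed.

Lemma k1_right_inverse A : in_k1 A ->
  exists2 B, in_k1 B & fps_comp A B =1 fps_Xn F 1.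
Proof.
move=> [A1 A0].
have [||B B0 AB] :=
  @newton_exists _ (fps_comp A) (fps_Xn F 1) 1 (A 1%N) A1 _ (fps_Xn F 1).
- move=> f g N N0 f0 fg; apply: fps_comp_sub => //; last rewrite -fg //.
    exact: f0.
  exact: f0.
- by move=> f f0 [|//] _; rewrite fps_comp0 A0.
have B00 : B 0 = 0 by rewrite B0.
exists B => //; split; last by case.
(* In degree 1 the equation reads A_1 B_1 = 1, so B_1 cannot vanish. *)
apply/eqP=> B10; have := AB 1%N.
have low l : (l < 1)%N -> B l = 0 by case: l.
rewrite (fps_comp_low (ltn0Sn 0) (A0 0 (ltn0Sn 0)) low (leqnn 1)) B10 mulr0.
by move/esym/eqP; rewrite oner_eq0.
Qed.

(** A right inverse B is also a left one: A o (B o A) = (A o B) o A = A = A o z, and A cancels on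
    the left. *)
Lemma k1_inverse A : in_k1 A -> exists B, is_k1_inverse B A.
Proof.
move=> kA; have [B kB AB] := k1_right_inverse kA.
have [A0 B0] := (k1_0 kA, k1_0 kB).
exists B; split=> //.
apply: (fps_comp_inj kA); rewrite ?fps_comp0 // => n.
rewrite fps_compA // (eq_fps_comp AB (frefl A)).
by rewrite fps_Xn1_comp // fps_comp_Xn1.
Qed.

Lemma has_order_comp_k1 A B m : (0 < m)%N -> in_k1 A -> has_order B m ->
  has_order (fps_comp A B) m.
Proof.
move=> m0 [A1 A0] [Bm B0]; have A00 : A 0 = 0 by exact: A0.
split=> [|j jm]; first by rewrite (fps_comp_low m0 A00 B0) ?mulf_neq0.
by rewrite (fps_comp_low m0 A00 B0) ?B0 ?mulr0 // ltnW.
Qed.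

(** * Parity, read off from the substitution A(-z) *)

Definition fps_flip A : fps F := fun n => (-1) ^+ n * A n.

Lemma fps_flip_exp A i : fps_flip (fps_exp A i) =1 fps_exp (fps_flip A) i.
Proof.
elim: i => [|i IH] n; first by case: n => [|n]; rewrite /fps_flip ?mul1r ?mulr0.
rewrite /fps_flip /= /fps_mul big_distrr; apply: eq_bigr => j _ /=.
rewrite -IH /fps_flip mulrACA -exprD subnKC //.
by rewrite -ltnS.
Qed.

Lemma fps_flip_comp A B : fps_flip (fps_comp A B) =1 fps_comp A (fps_flip B).
Proof.
move=> n; rewrite /fps_flip /fps_comp big_distrr; apply: eq_bigr => j _ /=.
by rewrite mulrCA -fps_flip_exp.
Qed.

Lemma fps_exp_scale (c : F) A i n :
  fps_exp (fun j => c * A j) i n = c ^+ i * fps_exp A i n.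
Proof.
elim: i n => [|i IH] n; first by rewrite mul1r.
rewrite /= /fps_mul big_distrr; apply: eq_bigr => j _ /=.
by rewrite IH exprS mulrACA.
Qed.

(** The boolean, [true] for odd, lets both halves of the theorem share one argument. *)
Definition fps_parity (e : bool) A := forall j, odd j != e -> A j = 0.

Lemma fps_comp_Xn2 A n :
  fps_comp A (fps_Xn F 2) n = if odd n then 0 else A n./2.
Proof.
rewrite /fps_comp; under eq_bigr do rewrite fps_exp_Xn /fps_Xn mul2n.
case: ifP => on.
  rewrite big1 // => i _; case: eqP => [ni|]; last by rewrite mulr0.
  by rewrite ni odd_double in on.
have hn : (n./2 < n.+1)%N by rewrite ltnS -{2}(odd_double_half n) -addnn addnA leq_addl.
rewrite (bigD1 (Ordinal hn)) //= big1 => [|i ni].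
  by rewrite -[n in n == _]odd_double_half on eqxx mulr1 addr0.
rewrite (_ : (n == _) = false) ?mulr0 //; apply: contraNF ni => /eqP ni.
by apply/eqP/val_inj; rewrite /= -[LHS]doubleK -ni.
Qed.

Lemma fps_evenP A : fps_even A <-> fps_parity false A.
Proof.
split=> [[R AR] j|A0].
  by rewrite AR fps_comp_Xn2 eqbF_neg negbK => ->.
exists (fun n => A n.*2) => n; rewrite fps_comp_Xn2.
by case: ifP => on; [rewrite A0 ?on | rewrite even_halfK ?on].
Qed.

Lemma fps_mul_Xn1 A n :
  fps_mul (fps_Xn F 1) A n = if n is n'.+1 then A n' else 0.
Proof.
rewrite (approx_mul (@approx_Xn _ n.+1 1) (@approx_trunc _ n.+1 A)) //.
by rewrite coefXM; case: n => //= n; rewrite -approx_trunc.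
Qed.

Lemma fps_oddP A : fps_odd A <-> fps_parity true A.
Proof.
split=> [[R AR] [|j]|A0].
- by rewrite AR fps_mul_Xn1.
- by rewrite AR fps_mul_Xn1 fps_comp_Xn2 /=; case: odd.
exists (fun n => A n.*2.+1) => [[|n]]; rewrite fps_mul_Xn1; first exact: A0.
rewrite fps_comp_Xn2; case: ifP => on; first by rewrite A0 //= on.
by rewrite even_halfK ?on.
Qed.

Lemma fps_parity_Xn m : fps_parity (odd m) (fps_Xn F m).
Proof. by move=> j; rewrite /fps_Xn; case: (j =P m) => [->|//]; rewrite eqxx. Qed.

(** At an index of the wrong parity, the functional equation makes the coefficient equal to its
    negative, hence zero as 2 is nonzero. *)
Lemma fps_parityP e A : 2%:R != 0 :> F ->
  fps_parity e A <-> fps_flip A =1 (fun n => (-1) ^+ e * A n).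
Proof.
move=> two0; split=> [A0 n|fA n ne].
  rewrite /fps_flip; have [<-|/A0 ->] := eqVneq (odd n) e; rewrite ?mulr0 //.
  by rewrite signr_odd.
have := fA n; rewrite /fps_flip -signr_odd (_ : odd n = ~~ e); last first.
  by move: ne; case: odd; case: (e).
rewrite signrN mulNr => /esym/eqP; rewrite -addr_eq0 -mulr2n -mulr_natl.
by rewrite !mulf_eq0 (negPf two0) signr_eq0 => /eqP.
Qed.

(* [B(-z)] and [(-1)^m B(z)] are [i.+1]-th roots of the same series with the same
   leading coefficient. *)
Lemma fps_parity_root e B m i : 2%:R != 0 :> F -> i.+1%:R != 0 :> F ->
    has_order B m -> fps_parity e (fps_exp B i.+1) ->
  e = odd (i.+1 * m) /\ fps_parity (odd m) B.
Proof.
move=> two0 i0 [Bm B0] eB.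
have [L0 L1] := fps_exp_low i.+1 B0.
(* The power has the nonzero coefficient B_m^(i+1) in degree (i+1) m, which must therefore have
   parity e. *)
have eE : e = odd (i.+1 * m).
  apply/eqP; rewrite eq_sym; apply: contraNT Bm => /eB.
  by rewrite L1 => /eqP; rewrite expf_eq0 => /andP[].
split=> //; apply/(fps_parityP _ _ two0).
apply: (@fps_exp_inj _ _ m i) => //.
- split=> [|j jm]; first by rewrite /fps_flip mulf_neq0 // signr_eq0.
  by rewrite /fps_flip B0 ?mulr0.
- split=> [|j jm]; first by rewrite mulf_neq0 // signr_eq0.
  by rewrite B0 ?mulr0.
- by rewrite /fps_flip signr_odd.
(* The two powers are B^(i+1) times (-1)^e and times (-1)^(m (i+1)), and these signs agree by
   [eE]. *)
move=> n; rewrite -fps_flip_exp fps_exp_scale.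
move/(fps_parityP _ _ two0): eB => ->.
by rewrite eE signr_odd signr_odd -exprM mulnC.
Qed.

(** Evenness of B o A gives B(A(-z)) = B(A(z)), and B cancels on the left. *)
Lemma fps_parity_comp_k1 B A : 2%:R != 0 :> F -> in_k1 B -> A 0 = 0 ->
  fps_parity false (fps_comp B A) -> fps_parity false A.
Proof.
move=> two0 kB A0 /(fps_parityP _ _ two0) eBA; apply/(fps_parityP _ _ two0).
move=> n; rewrite mul1r; apply: (fps_comp_inj kB) => // [|{}n].
  by rewrite /fps_flip A0 mulr0.
by rewrite -fps_flip_comp eBA mul1r.
Qed.

End Field.

(** * Decompositions of a series of given parity *)

Lemma closed_root (k : closedFieldType) (a : k) n : (0 < n)%N ->
  exists c, a = c ^+ n.
Proof.
(* The monic equation is x^n = a, with a as its only lower coefficient. *)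
move=> n0; have [c cE] := solve_monicpoly (fun i => if i == 0 then a else 0) n0.
exists c; rewrite cE; case: n n0 {cE} => // n _.
by rewrite big_ord_recl mulr1 big1 ?addr0 // => i _; rewrite mul0r.
Qed.

(* [nu] linearizes [A1] to [z^n] (a Boettcher coordinate). *)
Lemma decomposition_parity (k : closedFieldType) (char0 : [pchar k] =i pred0)
    (e : bool) (A A1 A2 : fps k) :
    in_Gamma A1 -> in_Gamma A2 -> fps_parity e A -> A =1 fps_comp A1 A2 ->
  exists (mu nu : fps k) (n m : nat),
    [/\ is_k1_inverse mu nu, e = odd (n * m), fps_comp A1 mu =1 fps_Xn k n,
        fps_parity (odd m) (fps_comp nu A2)
      & ~~ odd m -> fps_parity false A2].
Proof.
(* Characteristic zero serves both the root extraction and, as [nat0 1], the parity criterion. *)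
have nat0 i : i.+1%:R != 0 :> k by move/pcharf0P: char0 => ->.
case=> [[//|n] _ oA1] [m m2 oA2] eA AE.
have [c A1c] := closed_root (A1 n.+1) (ltn0Sn n).
have [nu knu A1E] := fps_root (nat0 n) oA1 A1c.
have [mu kmu] := k1_inverse knu; have [kmu1 _ _ numu] := kmu.
have m0 := ltnW m2; have A20 : A2 0 = 0 by case: oA2 => _; apply.
have oB := has_order_comp_k1 m0 knu oA2.
(* The power (nu o A2)^(n+1) equals nu^(n+1) o A2 = A1 o A2 = A; here [n.+1] is the order of
   [A1]. *)
have eB : fps_parity e (fps_exp (fps_comp nu A2) n.+1).
  move=> j je; rewrite -fps_comp_exp // -(eq_fps_comp A1E (frefl A2)) -AE.
  exact: eA.
have [eE pB] := fps_parity_root (nat0 1) (nat0 n) oB eB.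
exists mu, nu, n.+1, m; split=> // [j|m_even].
  rewrite (eq_fps_comp A1E (frefl mu)) fps_comp_exp ?(k1_0 kmu1) //.
  by rewrite (eq_fps_exp _ numu) fps_exp_Xn mul1n.
apply: (fps_parity_comp_k1 (nat0 1) knu A20).
by rewrite (negPf m_even) in pB.
Qed.

Theorem corollary6p5 (k : closedFieldType) (char0 : [pchar k] =i pred0) :
  (forall A : fps k, in_Gamma A -> fps_even A ->
     forall A1 A2 : fps k, in_Gamma A1 -> in_Gamma A2 ->
       A =1 fps_comp A1 A2 ->
       fps_even A2 \/
       exists mu nu : fps k,
         [/\ is_k1_inverse mu nu, fps_odd (fps_comp nu A2)
           & fps_even (fps_comp A1 mu)])
  /\
  (forall A : fps k, in_Gamma A -> fps_odd A ->
     forall A1 A2 : fps k, in_Gamma A1 -> in_Gamma A2 ->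
       A =1 fps_comp A1 A2 ->
       exists mu nu : fps k,
         [/\ is_k1_inverse mu nu, fps_odd (fps_comp A1 mu)
           & fps_odd (fps_comp nu A2)]).
Proof.
split=> A _ /[dup] pA _ A1 A2 GA1 GA2 AE.
  move/fps_evenP: pA => pA.
  have [mu [nu [n [m [kmu nm A1mu pB ev]]]]] :=
    decomposition_parity char0 GA1 GA2 pA AE.
  have [m_odd|/ev] := boolP (odd m); last by left; apply/fps_evenP.
  right; exists mu, nu; split=> //; first by apply/fps_oddP; rewrite -m_odd.
  (* Rewriting with [nm] turns the parity [false] into that of n m, which is that of n since m is
     odd. *)
  apply/fps_evenP => j; rewrite A1mu nm oddM m_odd andbT.
  exact: fps_parity_Xn.
move/fps_oddP: pA => pA.
have [mu [nu [n [m [kmu nm A1mu pB _]]]]] :=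
  decomposition_parity char0 GA1 GA2 pA AE.
move: nm; rewrite oddM => /esym/andP[n_odd m_odd].
exists mu, nu; split=> //; last by apply/fps_oddP; rewrite -m_odd.
by apply/fps_oddP => j; rewrite A1mu -n_odd; apply: fps_parity_Xn.
Qed.
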